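(* The following inequalities hold for all $h>0$ and all real sequences $f=(f_j)_{j\in\mathbb{Z}}\in\ell^2_h$, with constants $C$ independent of $h$ and $f$. (i) For any $0<s_2\le s_1<1$ there is $C=C(s_1,s_2)$ such that $\|f\|_{H^{s_2}_h}\le C\,\|f\|_{H^{s_1}_h}$. (ii) For any $0<s<1$ there is $C=C(s)$ such that $\|f\|_{H^s_h}\le C\,\big(\|f\|_{\ell^2_h}+\|D_h^+f\|_{\ell^2_h}\big)$. (iii) There is an absolute constant $C$ such that $\|D_hf\|_{\ell^2_h}\le C\,\|D_h^+f\|_{\ell^2_h}$, and moreover $\|D_h^+f\|_{\ell^2_h}\le|f|_{\dot H^1_h}$.
   Context: For $h>0$ and a real sequence $g=(g_j)_{j\in\mathbb{Z}}$: $\|g\|^2_{\ell^2_h}=\sum_{j\in\mathbb{Z}}g_j^2h$; for $s>0$, $|g|^2_{\dot H^s_h}=\sum_{j\in\mathbb{Z}}\sum_{k\in\mathbb{Z}\setminus\{0\}}\frac{(g_j-g_{j+k})^2}{|hk|^{1+2s}}h^2$; for $s\in(0,1)$, $\|g\|^2_{H^s_h}=\|g\|^2_{\ell^2_h}+|g|^2_{\dot H^s_h}$. Finite differences: $(D_h^+g)_j=\frac{g_{j+1}-g_j}{h}$, $(D_hg)_j=\frac{g_{j+1}-g_{j-1}}{2h}$. *)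

(* Defs.v *)
From HB Require Import structures.
From mathcomp Require Import all_boot all_order all_algebra.
From mathcomp Require Import all_classical all_reals all_analysis.
Set Implicit Arguments.
Unset Strict Implicit.
Unset Printing Implicit Defensive.
Import Order.TTheory GRing.Theory Num.Theory.
Local Open Scope classical_set_scope.
Local Open Scope ring_scope.

(* All the sums below have nonnegative terms, so they are taken in [\bar R] with
   [esum]: the squared norms and the norms are extended reals, equal to [+oo]
   exactly when the corresponding sum diverges. *)
Section discrete_sobolev.
Context {R : realType}.
Implicit Types (h s : R) (g : int -> R).

Definition l2h_normsq h g : \bar R :=
  \esum_(j in [set: int]) ((g j) ^+ 2 * h)%:E.

Definition l2h_norm h g : \bar R := sqrte (l2h_normsq h g).

Definition l2h h : set (int -> R) := [set g | (l2h_norm h g < +oo)%E].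

Definition dotHsh_seminormsq s h g : \bar R :=
  \esum_(j in [set: int]) \esum_(k in [set k : int | k != 0])
    ((g j - g (j + k)) ^+ 2 / (`|h * k%:~R| `^ (1 + 2 * s)) * h ^+ 2)%:E.

Definition dotHsh_seminorm s h g : \bar R := sqrte (dotHsh_seminormsq s h g).

Definition Hsh_normsq s h g : \bar R :=
  (l2h_normsq h g + dotHsh_seminormsq s h g)%E.

Definition Hsh_norm s h g : \bar R := sqrte (Hsh_normsq s h g).

Definition fwd_diff h g : int -> R := fun j => (g (j + 1) - g j) / h.

Definition ctr_diff h g : int -> R := fun j => (g (j + 1) - g (j - 1)) / (2 * h).

End discrete_sobolev.

(* Main.v *)
Require Import Defs.
From mathcomp Require Import all_boot all_order all_algebra.
From mathcomp Require Import all_classical all_reals all_analysis.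
From mathcomp Require Import ring lra.
Import Order.TTheory GRing.Theory Num.Theory.
Local Open Scope classical_set_scope.
Local Open Scope ring_scope.

(* Exchanging the sums gives |f|^2_{H^s} = 2 sum_{k >= 1} w_k T_k, with
   w_k = h / (h k)^(1 + 2 s) and T_k = ||f - f(. + k)||^2.  Both T_k <= 4 ||f||^2
   and T_k <= (h k)^2 ||D^+ f||^2 hold; the first is used when h k > 1, the second
   (or the comparison of the weights for s_2 <= s_1) when h k <= 1.  What is left is
   to bound sum_{h k > 1} h (h k)^(- 1 - 2 s) and sum_{h k <= 1} h (h k)^(1 - 2 s)
   uniformly in h > 0.  By Bernoulli's inequality their terms are, up to a constant,
   at most the increments between h (k - 1) and h k of the bounded functions
   - (1 + x)^(- 2 s) and min(x, 1)^(1 - s), so both sums telescope. *)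

(** * Bernoulli inequalities for real powers and the sums of the weights *)

Section power_functions.
Context {R : realType}.
Implicit Types a c h s t y z : R.

(** Write the power as [expR (- a * ln t)] and use [1 + x <= expR x], then [ln t <= t - 1]. *)
Lemma powR_bernoulli_neg a t : 0 <= a -> 0 < t ->
  1 - a * (t - 1) <= t `^ (- a).
Proof.
move=> a0 t0; rewrite /powR gt_eqF//; apply: le_trans (expR_ge1Dx _).
have /(ler_wpM2l a0) : ln t <= t - 1.
  by rewrite -{1}(subrK 1 t) addrC; apply: le_ln1Dx; lra.
lra.
Qed.

Lemma powR_bernoulli_le1 c t : 0 < c -> c < 1 -> 0 <= t ->
  t `^ c <= 1 + c * (t - 1).
Proof.
move=> c0 c1 t0.
have tc0 := powR_ge0 t c.
have p0 : 0 < c^-1 by rewrite invr_gt0.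
have q0 : 0 < (1 - c)^-1 by rewrite invr_gt0; lra.
have pq : c^-1^-1 + (1 - c)^-1^-1 = 1 by rewrite !invrK; lra.
have := conjugate_powR tc0 ler01 p0 q0 pq.
by rewrite !invrK mulr1 powR1 -powRrM mulfV ?gt_eqF// powRr1//; lra.
Qed.

Lemma powR_tangent_neg a y z : 0 <= a -> 0 < y -> 0 < z ->
  a * (z - y) * z `^ (- (1 + a)) <= y `^ (- a) - z `^ (- a).
Proof.
move=> a0 y0 z0; have [yz0 z0'] : 0 < y / z /\ z != 0.
  by rewrite divr_gt0 ?gt_eqF.
have -> : y `^ (- a) = z `^ (- a) * (y / z) `^ (- a).
  by rewrite -powRM ?ltW// mulrCA mulfV ?mulr1.
have -> : z `^ (- (1 + a)) = z `^ (- a) * z^-1.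
  by rewrite opprD addrC powRD ?powR_inv1 ?ltW// (negbTE z0') implybT.
have := ler_wpM2l (powR_ge0 z (- a)) (powR_bernoulli_neg a (y / z) a0 yz0).
set A := z `^ _; set B := (y / z) `^ _.
have -> : a * (z - y) * (A * z^-1) = A * (1 - a * (y / z - 1)) - A by field.
lra.
Qed.

(** The concave counterpart: the power lies below its tangent at [z]. *)
Lemma powR_tangent_le1 c y z : 0 < c -> c < 1 -> 0 <= y -> 0 < z ->
  c * (z - y) * z `^ (c - 1) <= z `^ c - y `^ c.
Proof.
move=> c0 c1 y0 z0; have [yz0 z0'] : 0 <= y / z /\ z != 0.
  by rewrite divr_ge0 ?gt_eqF// ltW.
have -> : y `^ c = z `^ c * (y / z) `^ c.
  by rewrite -powRM ?(ltW z0)// mulrCA mulfV ?mulr1.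
have -> : z `^ (c - 1) = z `^ c * z^-1.
  by rewrite powRD ?powR_inv1 ?ltW// (negbTE z0') implybT.
have := ler_wpM2l (powR_ge0 z c) (powR_bernoulli_le1 c _ c0 c1 yz0).
set A := z `^ _; set B := (y / z) `^ _.
have -> : c * (z - y) * (A * z^-1) = A - A * (1 + c * (y / z - 1)) by field.
lra.
Qed.

Lemma nneseries_telescope_le (w F : nat -> R) (M : R) :
  (forall k, 0 <= w k) -> (forall k, w k <= F k.+1 - F k) ->
  0 <= F 0%N -> (forall k, F k <= M) ->
  (\sum_(0 <= k <oo) (w k)%:E <= M%:E)%E.
Proof.
move=> w0 wF F0 FM; apply: lime_le.
  by apply: is_cvg_nneseries => k _ _; rewrite lee_fin.
apply: nearW => n; rewrite sumEFin lee_fin.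
apply: (@le_trans _ _ (\sum_(0 <= k < n) (F k.+1 - F k))).
  by apply: ler_sum => k _; exact: wF.
by rewrite telescope_sumr//; have := FM n; lra.
Qed.

(* In the weights below, the index [k] stands for the shift [k.+1]. *)
Definition near_weight s h k : R :=
  if h * k.+1%:R <= 1 then h * (h * k.+1%:R) `^ (1 - 2 * s) else 0.

Definition far_weight s h k : R :=
  if h * k.+1%:R <= 1 then 0 else h / (h * k.+1%:R) `^ (1 + 2 * s).

Lemma near_weight_ge0 s h k : 0 <= h -> 0 <= near_weight s h k.
Proof. by move=> h0; rewrite /near_weight; case: ifP; rewrite // mulr_ge0 ?powR_ge0. Qed.

Lemma far_weight_ge0 s h k : 0 <= h -> 0 <= far_weight s h k.
Proof. by move=> h0; rewrite /far_weight; case: ifP; rewrite // divr_ge0 ?powR_ge0. Qed.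

Lemma near_weight_sum s h : 0 < s -> s < 1 -> 0 < h ->
  (\sum_(0 <= k <oo) (near_weight s h k)%:E <= ((1 - s)^-1)%:E)%E.
Proof.
move=> s0 s1 h0; have c0 : 0 < 1 - s by lra.
(* An antiderivative of [x^(1 - 2s)] has exponent [2 - 2s], which may exceed 1. The exponent [1 - s]
   stays in [(0, 1)], where the concave tangent bound applies, and it suffices because
   [x^(1 - 2s) <= x^(- s)] for [0 < x <= 1]. *)
pose F k := (Order.min (h * k%:R) 1) `^ (1 - s) / (1 - s).
have hk0 k : 0 <= h * k%:R by rewrite mulr_ge0 ?ler0n// ltW.
apply: (@nneseries_telescope_le _ F).
- by move=> k; rewrite near_weight_ge0// ltW.
- move=> k; rewrite /near_weight /F -mulrBl ler_pdivlMr//.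
  have hkk : h * k%:R <= h * k.+1%:R by rewrite ler_wpM2l ?ler_nat// ltW.
  have z0 : 0 < h * k.+1%:R by rewrite mulr_gt0 ?ltr0n.
  case: ifPn => [hk1|_].
    rewrite !min_l//; last exact: le_trans hk1.
    apply: le_trans (powR_tangent_le1 _ _ _ c0 _ (hk0 k) z0); last by lra.
    have -> : h * k.+1%:R - h * k%:R = h by rewrite -natr1; ring.
    rewrite [leLHS]mulrC mulrA ler_wpM2l//; first by rewrite mulr_ge0// ltW.
    by apply: ger_powR; [rewrite z0 hk1|lra].
  rewrite mul0r subr_ge0 ge0_ler_powR ?nnegrE ?(ltW c0)//.
  + by rewrite le_min hk0 ler01.
  + by rewrite le_min (hk0 k.+1) ler01.
  + by rewrite le_min2.
- by rewrite /F divr_ge0 ?powR_ge0// ltW.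
- move=> k; rewrite /F -[leRHS]mul1r ler_wpM2r ?invr_ge0 ?(ltW c0)//.
  apply: (@le_trans _ _ (1 `^ (1 - s))); last by rewrite powR1.
  rewrite ge0_ler_powR ?nnegrE ?(ltW c0)//.
  + by rewrite le_min hk0 ler01.
  + by rewrite ge_min lexx orbT.
Qed.

Lemma far_weight_sum s h : 0 < s -> 0 < h ->
  (\sum_(0 <= k <oo) (far_weight s h k)%:E
    <= (2 `^ (1 + 2 * s) / (2 * s))%:E)%E.
Proof.
move=> s0 h0; have a0 : 0 < 2 * s by lra.
(* The divisor [2 * s] cancels the slope factor of the tangent. The power of 2 pays for replacing
   [x] by [1 + x], which keeps [F] bounded near 0 uniformly in [h]. *)
set V := 2 `^ _ / _.
have V0 : 0 < V by rewrite divr_gt0 ?powR_gt0.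
pose F k := V - V * (1 + h * k%:R) `^ (- (2 * s)).
have hk0 k : 0 <= h * k%:R by rewrite mulr_ge0 ?ler0n// ltW.
apply: (@nneseries_telescope_le _ F).
- by move=> k; rewrite far_weight_ge0// ltW.
- move=> k; have -> : F k.+1 - F k =
      V * ((1 + h * k%:R) `^ (- (2 * s)) - (1 + h * k.+1%:R) `^ (- (2 * s))).
    by rewrite /F; ring.
  have y0 : 0 < 1 + h * k%:R by have := hk0 k; lra.
  have z0 : 0 < 1 + h * k.+1%:R by have := hk0 k.+1; lra.
  have := powR_tangent_neg _ _ _ (ltW a0) y0 z0.
  have -> : 1 + h * k.+1%:R - (1 + h * k%:R) = h by rewrite -natr1; ring.
  move/(ler_wpM2l (ltW V0)); apply: le_trans.
  have -> : V * (2 * s * h * (1 + h * k.+1%:R) `^ (- (1 + 2 * s)))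
    = h * (2 `^ (1 + 2 * s) * (1 + h * k.+1%:R) `^ (- (1 + 2 * s))).
    by rewrite /V; field; lra.
  rewrite /far_weight; case: ifPn => [_|].
    by rewrite !mulr_ge0 ?powR_ge0// ltW.
  (* Here [x = h * k.+1%:R > 1], so [1 + x <= 2 * x]. *)
  rewrite -ltNge => hk1; rewrite ler_wpM2l ?(ltW h0)// powRN ler_pdivlMr ?powR_gt0//.
  rewrite mulrC ler_pdivrMr ?powR_gt0 ?(lt_trans ltr01)//.
  rewrite -powRM ?ler0n ?hk0//.
  by rewrite ge0_ler_powR ?nnegrE ?mulr_ge0 ?ler0n ?ltW//; lra.
- by rewrite /F mulr0 addr0 powR1 mulr1 subrr.
- by move=> k; rewrite /F gerBl mulr_ge0 ?powR_ge0// ltW.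
Qed.

End power_functions.

(** * Scaling, exchange and reindexing of nonnegative sums *)

Section esum_complements.
Context {R : realType}.
Local Open Scope ereal_scope.

Lemma ge0_esumZl (T : choiceType) (D : set T) (a : T -> \bar R) (c : R) :
  (0 <= c)%R -> (forall i, 0 <= a i) ->
  \esum_(i in D) (c%:E * a i) = c%:E * \esum_(i in D) a i.
Proof.
move=> c0 a0; rewrite /esum -ereal_supZl//; last first.
  apply/set0P; exists (\sum_(x \in set0) a x), set0 => //; exact: fsets_set0.
congr ereal_sup; apply/seteqP; split=> [_ [X DX <-]|_ [_ [X DX <-] <-]] /=.
  by exists (\sum_(x \in X) a x); [exists X|rewrite ge0_mule_fsumr].
by exists X => //; rewrite ge0_mule_fsumr.
Qed.

Lemma exchange_esum (T1 T2 : choiceType) (I : set T1) (J : set T2)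
    (a : T1 -> T2 -> \bar R) : (forall i j, 0 <= a i j) ->
  \esum_(i in I) \esum_(j in J) a i j = \esum_(j in J) \esum_(i in I) a i j.
Proof.
move=> a0; rewrite !esum_esum//.
rewrite (reindex_esum (J `*`` fun=> I) _ (fun x => (x.2, x.1)))//.
split=> [[j i] [/= Jj Ii]//|[j i] [j' i'] _ _ /= [-> ->]//|[i j] [/= Ii Jj]].
by exists (j, i).
Qed.

(** Opposite shifts are paired so that their equal contributions can later be merged into a factor
    2. *)
Lemma esum_nonzero_int (a : int -> \bar R) : (forall k, 0 <= a k) ->
  \esum_(k in [set k : int | k != 0%R]) a k =
  \sum_(0 <= k <oo) (a k.+1%:Z + a (- k.+1%:Z)%R).
Proof.
move=> a0; rewrite nneseries_esumT; last by move=> k; rewrite adde_ge0.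
rewrite esumD// (esumID [set k : int | (0 < k)%R])//; congr (_ + _).
  apply: (reindex_esum _ _ (fun k : nat => k.+1%:Z)); split=> //.
  - by move=> i j _ _ [].
  - by move=> [[|k]|k] [] //= _ _; exists k.
apply: (reindex_esum _ _ (fun k : nat => - k.+1%:Z)%R); split=> //.
- by move=> i j _ _ /oppr_inj [].
- by move=> [[|k]|k] [] //= _ _; exists k.
Qed.

End esum_complements.

(** * Norms of increments, and the seminorm as a weighted series of them *)

Section discrete_sobolev_norms.
Context {R : realType}.
Implicit Types (h s t : R) (f g a b : int -> R).

Definition increment f (k : int) : int -> R := fun j => f j - f (j + k).

Lemma l2h_normsq_ge0 h g : 0 <= h -> (0 <= l2h_normsq h g)%E.
Proof. by move=> h0; apply: esum_ge0 => j _; rewrite lee_fin mulr_ge0// sqr_ge0. Qed.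

Lemma l2h_normsq_shift h g (m : int) :
  l2h_normsq h (fun j => g (j + m)) = l2h_normsq h g.
Proof.
apply/esym; apply: (reindex_esum _ _ (fun j => j + m)); split=> //.
- by move=> i j _ _ /addIr.
- by move=> j _; exists (j - m) => //; rewrite subrK.
Qed.

Lemma l2h_normsqZ h t g : 0 <= h ->
  l2h_normsq h (fun j => t * g j) = ((t ^+ 2)%:E * l2h_normsq h g)%E.
Proof.
move=> h0; rewrite -ge0_esumZl ?sqr_ge0//.
  by apply: eq_esum => j _; rewrite -EFinM; congr EFin; ring.
by move=> j; rewrite lee_fin mulr_ge0// sqr_ge0.
Qed.

(** The two sides differ termwise by [t * (a j - t^-1 * b j) ^+ 2 * h]. The free parameter matters:
    [t = 1] gives crude bounds, while [t = 1 / k.+1%:R] gives the sharp quadratic growth of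
    increments. *)
Lemma l2h_normsqD_le h t a b : 0 <= h -> 0 < t ->
  (l2h_normsq h (fun j => a j + b j)%R
    <= (1 + t)%:E * l2h_normsq h a + (1 + t^-1)%:E * l2h_normsq h b)%E.
Proof.
move=> h0 t0; have ti0 : 0 < t^-1 by rewrite invr_gt0.
have P (c : int -> R) j : (0 <= (c j ^+ 2 * h)%:E)%E :> Prop.
  by rewrite lee_fin mulr_ge0// sqr_ge0.
rewrite -!ge0_esumZl ?addr_ge0 ?(ltW t0) ?(ltW ti0)// -esumD; last first.
- by move=> j _; rewrite mule_ge0// lee_fin addr_ge0// ltW.
- by move=> j _; rewrite mule_ge0// lee_fin addr_ge0// ltW.
apply: le_esum => j _; rewrite -!EFinM -EFinD lee_fin -subr_ge0.
have -> : (1 + t) * (a j ^+ 2 * h) + (1 + t^-1) * (b j ^+ 2 * h)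
    - (a j + b j) ^+ 2 * h = t * (a j - t^-1 * b j) ^+ 2 * h.
  by field; exact: lt0r_neq0.
by rewrite mulr_ge0 // mulr_ge0 ?sqr_ge0 // ltW.
Qed.

(** Translating the increment by [- k] through [k] gives the opposite of the increment by [k]. *)
Lemma l2h_normsq_incrementN h f (k : int) :
  l2h_normsq h (increment f (- k)) = l2h_normsq h (increment f k).
Proof.
rewrite -(l2h_normsq_shift _ _ k); apply: eq_esum => j _; congr EFin.
by rewrite /increment addrK; ring.
Qed.

Lemma l2h_normsq_increment_le h f (k : int) : 0 <= h ->
  (l2h_normsq h (increment f k) <= 4%:E * l2h_normsq h f)%E.
Proof.
move=> h0; apply: le_trans (l2h_normsqD_le h 1 _ _ h0 ltr01) _.
have -> : l2h_normsq h (fun j => - f (j + k)) = l2h_normsq h f.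
  rewrite -[RHS](l2h_normsq_shift _ _ k).
  by apply: eq_esum => j _; rewrite sqrrN.
rewrite -ge0_muleDl ?lee_fin ?invr1// -EFinD.
by rewrite (_ : 1 + 1 + (1 + 1) = 4 :> R)//; ring.
Qed.

(* Induction on [k], using (k + 1)^2 = (1 + 1/k) k^2 + (1 + k). *)
Lemma l2h_normsq_increment_sqr h f (k : nat) : 0 <= h ->
  (l2h_normsq h (increment f k.+1)
    <= (k.+1%:R ^+ 2)%:E * l2h_normsq h (increment f 1))%E.
Proof.
move=> h0; elim: k => [|k IH]; first by rewrite expr1n mul1e.
have k0 : 0 < k.+1%:R :> R by rewrite ltr0n.
have ki0 : 0 < k.+1%:R^-1 :> R by rewrite invr_gt0.
have -> : increment f k.+2 =
    (fun j => increment f k.+1 j + increment f 1 (j + k.+1%:Z)).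
  apply/funext => j; rewrite /increment.
  have -> : j + k.+2%:Z = j + k.+1%:Z + 1 by rewrite -addrA -PoszD addn1.
  by ring.
apply: le_trans (l2h_normsqD_le h _ _ _ h0 ki0) _.
rewrite (l2h_normsq_shift _ (increment f 1)) invrK.
have S0 := @l2h_normsq_ge0 h (increment f 1) h0.
apply: (@le_trans _ _ ((1 + k.+1%:R^-1)%:E *
    ((k.+1%:R ^+ 2)%:E * l2h_normsq h (increment f 1)) +
    (1 + k.+1%:R)%:E * l2h_normsq h (increment f 1))%E).
  by apply: leeD => //; apply: lee_wpmul2l => //; rewrite lee_fin addr_ge0// ltW.
rewrite muleA -EFinM -ge0_muleDl ?lee_fin -?EFinD; last 2 first.
- by rewrite mulr_ge0 ?sqr_ge0// addr_ge0// ltW.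
- by rewrite addr_ge0// ltW.
rewrite lee_wpmul2r// lee_fin -[k.+2%:R]natr1 le_eqVlt; apply/orP; left; apply/eqP.
by field; rewrite lt0r_neq0.
Qed.

Lemma l2h_normsq_fwd_diff h f : 0 < h ->
  l2h_normsq h (increment f 1) = ((h ^+ 2)%:E * l2h_normsq h (fwd_diff h f))%E.
Proof.
move=> h0; rewrite -l2h_normsqZ ?ltW//; apply: eq_esum => j _; congr EFin.
by rewrite /increment /fwd_diff; field; rewrite lt0r_neq0.
Qed.

(** Of the factor [h ^+ 2] in the seminorm, one [h] goes here and the other into [l2h_normsq]. *)
Definition dotHsh_weight s h (k : nat) : R := h / (h * k.+1%:R) `^ (1 + 2 * s).

Lemma dotHsh_weight_ge0 s h k : 0 <= h -> 0 <= dotHsh_weight s h k.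
Proof. by move=> h0; rewrite divr_ge0 ?powR_ge0. Qed.

Lemma dotHsh_seminormsqE s h f : 0 < h ->
  dotHsh_seminormsq s h f = (2%:E * \sum_(0 <= k <oo)
    ((dotHsh_weight s h k)%:E * l2h_normsq h (increment f k.+1)))%E.
Proof.
move=> h0; rewrite /dotHsh_seminormsq exchange_esum; last first.
  by move=> j k; rewrite lee_fin mulr_ge0 ?divr_ge0 ?powR_ge0 ?sqr_ge0.
rewrite esum_nonzero_int; last first.
  move=> k; apply: esum_ge0 => j _.
  by rewrite lee_fin mulr_ge0 ?divr_ge0 ?powR_ge0 ?sqr_ge0.
rewrite -nneseriesZl; last first.
  by move=> k _; rewrite mule_ge0 ?l2h_normsq_ge0 ?lee_fin ?dotHsh_weight_ge0 ?ltW.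
apply: eq_eseriesr => k _.
(* The weight depends on the shift only through its absolute value, so one computation serves both
   [k.+1] and its opposite. *)
have slice (m : int) : `|h * m%:~R| = h * k.+1%:R ->
  (\esum_(j in [set: int]) ((f j - f (j + m)) ^+ 2 /
     (`|h * m%:~R| `^ (1 + 2 * s)) * h ^+ 2)%:E
   = (dotHsh_weight s h k)%:E * l2h_normsq h (increment f m))%E.
  move=> ->; rewrite -ge0_esumZl ?dotHsh_weight_ge0 ?ltW//; last first.
    by move=> j; rewrite lee_fin mulr_ge0 ?sqr_ge0// ltW.
  apply: eq_esum => j _; rewrite -EFinM; congr EFin.
  by rewrite /dotHsh_weight /increment; ring.
have hk0 : 0 <= h * k.+1%:R by rewrite mulr_ge0// ltW.
rewrite !slice.
- rewrite l2h_normsq_incrementN -mule2n -[in RHS](natr1 1) EFinD ge0_muleDl//.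
  by rewrite !mul1e mule2n.
- by rewrite mulrNz mulrN normrN ger0_norm.
- by rewrite ger0_norm.
Qed.

End discrete_sobolev_norms.

(** * Bounds for the squared seminorms and difference quotients *)

Section seminorm_bounds.
Context {R : realType}.
Implicit Types (h s K : R) (f : int -> R).

Lemma dotHsh_seminormsq_ge0 s h f : (0 <= dotHsh_seminormsq s h f)%E.
Proof.
apply: esum_ge0 => j _; apply: esum_ge0 => k _.
by rewrite lee_fin mulr_ge0 ?divr_ge0 ?powR_ge0 ?sqr_ge0.
Qed.

Lemma l2h_normsq_fin h f : 0 < h -> l2h h f -> l2h_normsq h f \is a fin_num.
Proof.
rewrite /l2h/= /l2h_norm => h0.
have := @l2h_normsq_ge0 R h f (ltW h0).
by case: (l2h_normsq h f).
Qed.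

(** The bound [h^2 ||D^+ f||^2 <= 4 ||f||^2] excludes [+oo]; its dependence on [h] is harmless, as
    only finiteness is kept. *)
Lemma l2h_normsq_fwd_diff_fin h f : 0 < h -> l2h h f ->
  l2h_normsq h (fwd_diff h f) \is a fin_num.
Proof.
move=> h0 /(l2h_normsq_fin _ _ h0) Lf.
have D0 := @l2h_normsq_ge0 R h (fwd_diff h f) (ltW h0).
have := @l2h_normsq_increment_le R h f 1 (ltW h0).
rewrite l2h_normsq_fwd_diff// -(fineK Lf).
move: D0; case: (l2h_normsq h (fwd_diff h f)) => // _.
by rewrite gt0_muley ?lte_fin ?exprn_gt0// -EFinM.
Qed.

(* [8 = 2 * 4]: two signs of the shift, and [T_k <= 4 ||f||^2]. *)
Definition far_const s : R := 8 * (2 `^ (1 + 2 * s) / (2 * s)).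

Lemma far_const_ge0 s : 0 < s -> 0 <= far_const s.
Proof. by move=> s0; rewrite mulr_ge0// divr_ge0 ?powR_ge0// mulr_ge0// ltW. Qed.

(** The common core of (i) and (ii). The near bound [a] is left open: it is the term of the [s1]
    series in (i), and a multiple of [near_weight] in (ii). *)
Lemma dotHsh_seminormsq_split_le s h f (a : nat -> \bar R) : 0 < s -> 0 < h ->
  l2h h f -> (forall k, 0 <= a k)%E ->
  (forall k, (h * k.+1%:R <= 1)%R ->
    (dotHsh_weight s h k)%:E * l2h_normsq h (increment f k.+1) <= a k)%E ->
  (dotHsh_seminormsq s h f <=
    2%:E * \sum_(0 <= k <oo) a k + (far_const s)%:E * l2h_normsq h f)%E.
Proof.
move=> s0 h0 lf a0 wa; have L0 := @l2h_normsq_ge0 R h f (ltW h0).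
have Lf := l2h_normsq_fin _ _ h0 lf.
set L := fine (l2h_normsq h f); have LE : l2h_normsq h f = L%:E by rewrite fineK.
have L4 : 0 <= 4 * L by rewrite mulr_ge0// fine_ge0.
have v0 k : (0 <= (far_weight s h k)%:E)%E by rewrite lee_fin far_weight_ge0// ltW.
have Lv0 k : (0 <= (4 * L)%:E * (far_weight s h k)%:E)%E by rewrite mule_ge0.
rewrite dotHsh_seminormsqE//.
(* Each term is bounded by one of the two summands, according to the size of [h * k.+1%:R]; the
   other is nonnegative. *)
apply: (@le_trans _ _ (2%:E * \sum_(0 <= k <oo)
    (a k + (4 * L)%:E * (far_weight s h k)%:E))%E).
  apply: lee_wpmul2l => //; apply: lee_nneseries => [k _ _|k _].
    by rewrite mule_ge0 ?l2h_normsq_ge0 ?lee_fin ?dotHsh_weight_ge0 ?ltW.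
  have [hk|hk] := leP (h * k.+1%:R) 1.
    by apply: le_trans (wa k hk) _; rewrite leeDl.
  have -> : far_weight s h k = dotHsh_weight s h k.
    by rewrite /far_weight leNgt hk.
  apply: (@le_trans _ _ ((4 * L)%:E * (dotHsh_weight s h k)%:E)%E).
    rewrite muleC; apply: lee_wpmul2r.
      by rewrite lee_fin dotHsh_weight_ge0// ltW.
    by rewrite EFinM -LE; exact/l2h_normsq_increment_le/ltW.
  by rewrite leeDr.
rewrite nneseriesD// ge0_muleDr ?nneseries_ge0// leeD2l// nneseriesZl//.
rewrite muleA -EFinM LE.
apply: le_trans (lee_wpmul2l _ (far_weight_sum s h s0 h0)) _.
  by rewrite lee_fin mulr_ge0.
by rewrite -!EFinM lee_fin /far_const; lra.
Qed.

Lemma dotHsh_seminormsq_monotone s1 s2 h f : 0 < s2 -> s2 <= s1 -> 0 < h ->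
  l2h h f -> (dotHsh_seminormsq s2 h f <=
    dotHsh_seminormsq s1 h f + (far_const s2)%:E * l2h_normsq h f)%E.
Proof.
move=> s20 s21 h0 lf; rewrite (dotHsh_seminormsqE s1)//.
have T0 k := @l2h_normsq_ge0 R h (increment f k) (ltW h0).
apply: dotHsh_seminormsq_split_le => // k; first by
  rewrite mule_ge0// lee_fin dotHsh_weight_ge0// ltW.
(* On [(0, 1]] a larger exponent gives a smaller power, hence a larger weight. *)
move=> hk1; have hk0 : 0 < h * k.+1%:R by rewrite mulr_gt0.
apply: lee_wpmul2r => //; rewrite lee_fin /dotHsh_weight.
rewrite ler_wpM2l ?(ltW h0)// lef_pV2 ?posrE ?powR_gt0//.
by apply: ger_powR; [rewrite hk0 hk1|lra].
Qed.

Lemma dotHsh_seminormsq_fwd_diff s h f : 0 < s -> s < 1 -> 0 < h ->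
  l2h h f -> (dotHsh_seminormsq s h f <=
    (2 / (1 - s))%:E * l2h_normsq h (fwd_diff h f)
    + (far_const s)%:E * l2h_normsq h f)%E.
Proof.
move=> s0 s1 h0 lf; have D0 := @l2h_normsq_ge0 R h (fwd_diff h f) (ltW h0).
have Df := l2h_normsq_fwd_diff_fin _ _ h0 lf.
set D := fine (l2h_normsq h (fwd_diff h f)).
have DE : l2h_normsq h (fwd_diff h f) = D%:E by rewrite fineK.
have D0' : 0 <= D by rewrite fine_ge0.
have u0 k : (0 <= (near_weight s h k)%:E)%E by rewrite lee_fin near_weight_ge0// ltW.
have Du0 k : (0 <= D%:E * (near_weight s h k)%:E)%E by rewrite mule_ge0.
apply: le_trans (dotHsh_seminormsq_split_le s h f
  (fun k => D%:E * (near_weight s h k)%:E)%E s0 h0 lf Du0 _) _.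
  move=> k hk1; have hk0 : 0 < h * k.+1%:R by rewrite mulr_gt0.
  rewrite /near_weight hk1.
  apply: le_trans (lee_wpmul2l _ (l2h_normsq_increment_sqr _ _ _ (ltW h0))) _.
    by rewrite lee_fin dotHsh_weight_ge0// ltW.
  rewrite l2h_normsq_fwd_diff// DE -!EFinM lee_fin /dotHsh_weight le_eqVlt.
  apply/orP; left; apply/eqP.
  (* The quadratic increment bound contributes [(h * k.+1%:R) ^+ 2], which turns [dotHsh_weight]
     into [near_weight]. *)
  have -> : 1 - 2 * s = 2 - (1 + 2 * s) by ring.
  rewrite powRB; last by rewrite (gt_eqF hk0) implybT.
  by rewrite powR_mulrn ?(ltW hk0)//; ring.
rewrite nneseriesZl// leeD2r// DE muleA -EFinM.
apply: le_trans (lee_wpmul2l _ (near_weight_sum s h s0 s1 h0)) _.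
  by rewrite lee_fin mulr_ge0.
by rewrite -!EFinM lee_fin le_eqVlt; apply/orP; left; apply/eqP; ring.
Qed.

(** The central difference is the mean of two translates of the forward one, and
    [(1/4) * (2 + 2) = 1]. *)
Lemma l2h_normsq_ctr_diff h f : 0 < h ->
  (l2h_normsq h (ctr_diff h f) <= l2h_normsq h (fwd_diff h f))%E.
Proof.
move=> h0; have -> : ctr_diff h f =
    (fun j => 2^-1 * (fwd_diff h f j + fwd_diff h f (j + (- 1)))).
  apply/funext => j; rewrite /ctr_diff /fwd_diff subrK.
  by field; rewrite lt0r_neq0.
rewrite l2h_normsqZ ?(ltW h0)//.
apply: le_trans (lee_wpmul2l _ (l2h_normsqD_le _ 1 _ _ (ltW h0) ltr01)) _.
  by rewrite lee_fin sqr_ge0.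
have D0 := @l2h_normsq_ge0 R h (fwd_diff h f) (ltW h0).
rewrite (l2h_normsq_shift _ (fwd_diff h f)) invr1 -ge0_muleDl ?lee_fin// -EFinD.
by rewrite muleA -EFinM (_ : 2^-1 ^+ 2 * _ = 1 :> R) ?mul1e//; field.
Qed.

(** Keep only the unit shift in the series: its weight [h / h^3] cancels the [h^2] from the
    increment, and the factor 2 is dropped. *)
Lemma l2h_normsq_fwd_diff_le h f : 0 < h ->
  (l2h_normsq h (fwd_diff h f) <= dotHsh_seminormsq 1 h f)%E.
Proof.
move=> h0; rewrite dotHsh_seminormsqE//.
have D0 := @l2h_normsq_ge0 R h (fwd_diff h f) (ltW h0).
have S0 k : (0 <= (dotHsh_weight 1 h k)%:E * l2h_normsq h (increment f k.+1))%E.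
  by rewrite mule_ge0 ?l2h_normsq_ge0 ?lee_fin ?dotHsh_weight_ge0 ?ltW.
have := @nneseries_lim_ge R _ xpredT 0%N 1 (fun k _ _ => S0 k).
rewrite big_nat1 l2h_normsq_fwd_diff// muleA -EFinM.
have -> : dotHsh_weight 1 h 0 * h ^+ 2 = 1.
  rewrite /dotHsh_weight (_ : 1 + 2 * 1 = 3%:R); last by ring.
  rewrite mulr1 powR_mulrn; last exact: ltW.
  by field; rewrite lt0r_neq0.
rewrite mul1e => /le_trans; apply; apply: lee_pemull => //.
  by apply: nneseries_ge0.
by rewrite lee_fin ler1n.
Qed.

(** * From squared norms to norms *)

Lemma sqrteD_le (x y : \bar R) : (0 <= x -> 0 <= y ->
  sqrte (x + y) <= sqrte x + sqrte y)%E.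
Proof.
case: x => [x| |] // x0; case: y => [y| |] // y0.
rewrite -EFinD /= -EFinD lee_fin; rewrite !lee_fin in x0 y0.
rewrite -(@ler_pXn2r _ 2) ?nnegrE ?addr_ge0 ?sqrtr_ge0//.
rewrite sqrrD !sqr_sqrtr ?addr_ge0//.
by have := mulr_ge0 (sqrtr_ge0 x) (sqrtr_ge0 y); lra.
Qed.

Lemma sqrte_leZ K (x y : \bar R) : 0 <= K -> (0 <= y -> x <= K%:E * y ->
  sqrte x <= (Num.sqrt K)%:E * sqrte y)%E.
Proof.
move=> K0 y0 xy; rewrite (_ : (Num.sqrt K)%:E = sqrte K%:E)// -sqrteM ?lee_fin//.
by rewrite lee_sqrt// mule_ge0.
Qed.

End seminorm_bounds.

Theorem proposition4p8 (R : realType) :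
  (forall s1 s2 : R, 0 < s2 -> s2 <= s1 -> s1 < 1 ->
     exists C : R, 0 < C /\
       forall (h : R) (f : int -> R), 0 < h -> l2h h f ->
         (Hsh_norm s2 h f <= C%:E * Hsh_norm s1 h f)%E)
  /\
  (forall s : R, 0 < s -> s < 1 ->
     exists C : R, 0 < C /\
       forall (h : R) (f : int -> R), 0 < h -> l2h h f ->
         (Hsh_norm s h f
            <= C%:E * (l2h_norm h f + l2h_norm h (fwd_diff h f)))%E)
  /\
  ((exists C : R, 0 < C /\
      forall (h : R) (f : int -> R), 0 < h -> l2h h f ->
        (l2h_norm h (ctr_diff h f) <= C%:E * l2h_norm h (fwd_diff h f))%E)
   /\
   (forall (h : R) (f : int -> R), 0 < h -> l2h h f ->
      (l2h_norm h (fwd_diff h f) <= dotHsh_seminorm 1 h f)%E)).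
Proof.
split; [|split; [|split]].
- move=> s1 s2 s20 s21 s11; have V0 := far_const_ge0 _ s20.
  (* With [L] the squared norm, [H] the [s1] seminorm squared and [V] the far constant,
     [L + (H + V L) <= (1 + V) (L + H)]. *)
  exists (Num.sqrt (1 + far_const s2)); split; first by rewrite sqrtr_gt0; lra.
  move=> h f h0 lf; have L0 := @l2h_normsq_ge0 R h f (ltW h0).
  have H0 := dotHsh_seminormsq_ge0 s1 h f.
  apply: sqrte_leZ; [by lra|exact: adde_ge0|].
  apply: le_trans (leeD2l _ (dotHsh_seminormsq_monotone _ _ _ _ s20 s21 h0 lf)) _.
  rewrite EFinD ge0_muleDl ?lee_fin// mul1e addeA leeD2l//.
  by rewrite lee_wpmul2l ?lee_fin// /Hsh_normsq leeDl.
- move=> s s0 s1; have V0 := far_const_ge0 _ s0.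
  have U0 : 0 <= 2 / (1 - s) by rewrite divr_ge0//; lra.
  (* Under the root, the constant dominates both coefficients: [1 + far_const s] of [||f||^2] and
     [2 / (1 - s)] of [||D^+ f||^2]. *)
  exists (Num.sqrt (1 + 2 / (1 - s) + far_const s)); split.
    by rewrite sqrtr_gt0; lra.
  move=> h f h0 lf; have L0 := @l2h_normsq_ge0 R h f (ltW h0).
  have D0 := @l2h_normsq_ge0 R h (fwd_diff h f) (ltW h0).
  apply: (@le_trans _ _ ((Num.sqrt (1 + 2 / (1 - s) + far_const s))%:E *
     sqrte (l2h_normsq h f + l2h_normsq h (fwd_diff h f)))%E); last first.
    by rewrite lee_wpmul2l ?lee_fin ?sqrtr_ge0 ?sqrteD_le.
  apply: sqrte_leZ; [by lra|exact: adde_ge0|].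
  apply: le_trans (leeD2l _ (dotHsh_seminormsq_fwd_diff _ _ _ s0 s1 h0 lf)) _.
  rewrite -(fineK (l2h_normsq_fin _ _ h0 lf)).
  rewrite -(fineK (l2h_normsq_fwd_diff_fin _ _ h0 lf)).
  have Lr0 := fine_ge0 L0; have Dr0 := fine_ge0 D0.
  set L := fine _ in Lr0 *; set D := fine _ in Dr0 *.
  rewrite -[(L%:E + D%:E)%E]EFinD -!EFinM -!EFinD lee_fin.
  have := mulr_ge0 V0 Dr0; have := mulr_ge0 U0 Lr0.
  by lra.
- exists 1; split=> // h f h0 _.
  rewrite mul1e lee_sqrt ?l2h_normsq_ge0 ?(ltW h0)//.
  exact: l2h_normsq_ctr_diff.
- move=> h f h0 _; rewrite lee_sqrt ?dotHsh_seminormsq_ge0//.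
  exact: l2h_normsq_fwd_diff_le.
Qed.
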